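(* Suppose $f$ is a nonnegative function on $[0,1]^n$ for which $f^{1/n}\in C^{0,1}([0,1]^n)$, and let $v$ be the maximal viscosity solution of (P2). Then $v\in C^{0,1}([0,1]^n)$ and $$[v]_{1;[0,1]^n}\le C\,\|f^{\frac{n-1}{n}}\|_{L^\infty([0,1]^n)}\,\|f^{\frac1n}\|_{C^{0,1}([0,1]^n)},$$ where $C$ is a constant depending only on $n$.
   Context: $n\ge1$ is an integer, $a_+=\max(a,0)$, $\Gamma=\partial[0,1]^n\setminus(0,1]^n$. $[g]_{1;[0,1]^n}=\sup_{x\ne y}|g(x)-g(y)|/|x-y|$ is the Lipschitz seminorm and $\|g\|_{C^{0,1}([0,1]^n)}=\sup_{[0,1]^n}|g|+[g]_{1;[0,1]^n}$. A function is nondecreasing if it is nondecreasing in each coordinate separately. Problem (P1): $(u_{x_1})_+\cdots(u_{x_n})_+=f$ in $(0,1]^n$, $u=0$ on $\Gamma$. A viscosity solution of (P1) is a continuous $u:[0,1]^n\to\mathbb{R}$ with $u=0$ on $\Gamma$ such that for every $x_0\in(0,1]^n$ and every $C^1$ function $\phi$: if $u-\phi$ has a local maximum (resp. minimum) at $x_0$ relative to $(0,1]^n$, then $\prod_i(\phi_{x_i}(x_0))_+\le f(x_0)$ (resp. $\ge f(x_0)$). For continuous nonnegative $f$ there is a unique nondecreasing viscosity solution $u$ of (P1). Problem (P2): $(v_{x_1})_+\cdots(v_{x_n})_+=v^{n-1}f$ in $(0,1]^n$, $v=0$ on $\Gamma$. The maximal viscosity solution of (P2) is by definition $v=u^n/n^n$,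 where $u$ is the nondecreasing viscosity solution of (P1). *)

(* Defs.v *)
From HB Require Import structures.
From mathcomp Require Import all_boot all_order all_algebra.
From mathcomp Require Import all_classical all_reals all_analysis.

Set Implicit Arguments.
Unset Strict Implicit.
Unset Printing Implicit Defensive.

Import Order.TTheory GRing.Theory Num.Theory.
Import numFieldNormedType.Exports.

Local Open Scope classical_set_scope.
Local Open Scope ring_scope.

(* Points of R^n are row vectors.  The library norm on 'rV[R]_n is the max
   norm; it induces the same topology and the same derivatives as the Euclidean
   norm, but the Lipschitz seminorm below is measured with the latter. *)

Definition enorm (R : realType) (n : nat) (x : 'rV[R]_n) : R :=
  Num.sqrt (\sum_(i < n) x 0 i ^+ 2).

(* [0,1]^n *)
Definition cube (R : realType) (n : nat) : set 'rV[R]_n :=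
  [set x | forall i, 0 <= x 0 i <= 1].

(* (0,1]^n *)
Definition lo_cube (R : realType) (n : nat) : set 'rV[R]_n :=
  [set x | forall i, 0 < x 0 i <= 1].

(* Gamma, the boundary of [0,1]^n minus (0,1]^n *)
Definition cube_gamma (R : realType) (n : nat) : set 'rV[R]_n :=
  (closure (@cube R n) `\` interior (@cube R n)) `\` @lo_cube R n.

Definition partial (R : realType) (n : nat) (i : 'I_n) (phi : 'rV[R]_n -> R)
    (x : 'rV[R]_n) : R :=
  'D_(delta_mx 0 i) phi x.

Definition C1 (R : realType) (n : nat) (phi : 'rV[R]_n -> R) : Prop :=
  (forall x, differentiable phi x) /\ forall i, continuous (partial i phi).

(* Functions on [0,1]^n are total functions of which only the values on the
   cube are ever used. *)

Definition nondecreasing_cube (R : realType) (n : nat) (u : 'rV[R]_n -> R) :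
    Prop :=
  forall (i : 'I_n) (x y : 'rV[R]_n), cube x -> cube y ->
    (forall j, j != i -> x 0 j = y 0 j) -> x 0 i <= y 0 i -> u x <= u y.

(* Viscosity solution of (u_{x_1})_+ ... (u_{x_n})_+ = f in (0,1]^n, u = 0 on
   Gamma; the extrema of u - phi are local relative to (0,1]^n. *)
Definition viscosity_solution_P1 (R : realType) (n : nat)
    (f u : 'rV[R]_n -> R) : Prop :=
  [/\ {within @cube R n, continuous u},
      forall x, cube_gamma x -> u x = 0
    & forall (x0 : 'rV[R]_n) (phi : 'rV[R]_n -> R), lo_cube x0 -> C1 phi ->
        ((\forall x \near within (@lo_cube R n) (nbhs x0),
            u x - phi x <= u x0 - phi x0) ->
          \prod_(i < n) Num.max (partial i phi x0) 0 <= f x0) /\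
        ((\forall x \near within (@lo_cube R n) (nbhs x0),
            u x0 - phi x0 <= u x - phi x) ->
          f x0 <= \prod_(i < n) Num.max (partial i phi x0) 0)].

(* The maximal viscosity solution of
     (v_{x_1})_+ ... (v_{x_n})_+ = v^(n-1) f in (0,1]^n, v = 0 on Gamma,
   is by definition u^n / n^n, where u is the (unique) nondecreasing viscosity
   solution of (u_{x_1})_+ ... (u_{x_n})_+ = f. *)
Definition maximal_viscosity_solution_P2 (R : realType) (n : nat)
    (f v : 'rV[R]_n -> R) : Prop :=
  exists u : 'rV[R]_n -> R,
    [/\ viscosity_solution_P1 f u, nondecreasing_cube u
      & forall x, cube x -> v x = u x ^+ n / n%:R ^+ n].

(* The (semi)norms take their values in the extended reals, +oo meaning that
   the function is not in the corresponding space. *)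

Definition lip_seminorm (R : realType) (n : nat) (g : 'rV[R]_n -> R) : \bar R :=
  ereal_sup [set (`|g p.1 - g p.2| / enorm (p.1 - p.2))%:E
    | p in [set p : 'rV[R]_n * 'rV[R]_n | [/\ cube p.1, cube p.2 & p.1 != p.2]]].

Definition sup_norm (R : realType) (n : nat) (g : 'rV[R]_n -> R) : \bar R :=
  ereal_sup [set `|g x|%:E | x in @cube R n].

Definition C01_norm (R : realType) (n : nat) (g : 'rV[R]_n -> R) : \bar R :=
  (sup_norm g + lip_seminorm g)%E.

Definition in_C01 (R : realType) (n : nat) (g : 'rV[R]_n -> R) : Prop :=
  (C01_norm g < +oo)%E.

(* Lebesgue measure on [0,1]^n, as the n-fold product of the Lebesgue measure
   on [0,1] (which is the uniform probability on [0,1]).  The library puts the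
   product sigma-algebra on tuples, so it is a measure on tuples. *)

Definition tcons d (T : measurableType d) (n : nat) (p : T * n.-tuple T) :
    n.+1.-tuple T :=
  [tuple of p.1 :: p.2].

Lemma measurable_tcons d (T : measurableType d) (n : nat) :
  measurable_fun [set: T * n.-tuple T] (@tcons d T n).
Proof. exact: measurable_cons. Qed.

HB.instance Definition _ d (T : measurableType d) (n : nat) :=
  isMeasurableFun.Build _ _ _ _ (@tcons d T n) (@measurable_tcons d T n).

Fixpoint lebesgue_cube (R : realType) (n : nat) :
    probability (n.-tuple (measurableTypeR R)) R :=
  match n with
  | 0 => dirac [tuple]
  | n'.+1 =>
      distribution (uniform_prob (@ltr01 R) \x lebesgue_cube R n')%E
        (@tcons _ (measurableTypeR R) n')
  end.

(* L^oo([0,1]^n) norm: essential supremum of |g| for Lebesgue measure *)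
Definition Linfty_norm (R : realType) (n : nat) (g : 'rV[R]_n -> R) : \bar R :=
  Lnorm (lebesgue_cube R n) +oo%E
    (fun t : n.-tuple (measurableTypeR R) => (g (\row_i tnth t i))%:E).

(* Main.v *)
Require Import Defs.
From mathcomp Require Import all_boot all_order all_algebra.
From mathcomp Require Import all_classical all_reals all_analysis.
From mathcomp Require Import ess_sup_inf ring lra.

Set Implicit Arguments.
Unset Strict Implicit.
Unset Printing Implicit Defensive.

Import Order.TTheory GRing.Theory Num.Theory.
Import numFieldNormedType.Exports.

Local Open Scope classical_set_scope.
Local Open Scope ring_scope.

(** Write F = f^(1/n), let M be the maximum of F on the cube and L its
    Lipschitz constant, and let u be the nondecreasing solution of
    (u_(x_1))_+ ... (u_(x_n))_+ = f, so that v = u^n / n^n.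

    Heuristically u(x) is n times the supremum, over monotone curves g ending at
    x, of the integral of F(g) (g_1' ... g_n')^(1/n).  Contracting the k-th
    coordinate of such a curve by a factor lam multiplies the integrand by
    lam^(-1/n) and moves the curve by at most the distance between its old and
    new end points, hence it changes F by at most L times that distance.  Two
    points y and x that differ only in coordinate k, with x_k <= y_k and
    lam = y_k / x_k, should therefore satisfy
      u(y) <= lam^(1/n) (u(x) + C L (y_k - x_k)),
    where C depends on n only.  Raising this to the power n produces the error
    (1 - 1/lam) u(y)^n, which is harmless because u^n <= n^n M^n x_k: the
    solution vanishes on the faces through the origin at the rate x_k^(1/n).
    This is why v is Lipschitz up to these faces whereas u need not be.

    No curves are needed to prove the two inequalities for viscosity solutions.
    The growth bound [sol_pow_le] is a comparison of u with linear
    supersolutions.  The scaling inequality [scaling_comparison] is a comparison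
    of the contracted u with lam^(1/n) (u + K y_k (1 + sum_i y_i)),
    K = L (lam - 1), by doubling of variables [scaling_comparison_eps].  There
    the penalty couples X with the contraction of X, so both variables range
    over the whole cube and the extrema are relative to the full set (0,1]^n, as
    the definition of a viscosity solution requires.  That the perturbed u is
    again a supersolution rests on the superadditivity of the geometric mean
    [prod_shift_ge_pow].

    Summing over the coordinates bounds the Lipschitz constant of v by
    n (M^n + (n+1) L M^(n-1)) <= n (n+1) M^(n-1) (M + L).  Finally M^(n-1) is at
    most the essential supremum of F^(n-1), since F is continuous and every
    small box of the cube has positive measure [Linfty_norm_ge]. *)

(** * Geometric means *)

Lemma AGM_root_le_sum (R : realType) (n : nat) (e : 'I_n -> R) (q : R) :
  (0 < n)%N -> 0 <= q -> (forall i, 0 <= e i) -> q ^+ n <= \prod_i e i ->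
  n%:R * q <= \sum_i e i.
Proof.
move=> n0 q0 e0 qe.
have := (@leif_AGM R 'I_n predT e (fun i _ => e0 i)).1.
rewrite /= card_ord => /(le_trans qe).
rewrite ler_pXn2r// ?nnegrE ?divr_ge0 ?ler0n ?sumr_ge0//.
by rewrite ler_pdivlMr ?ltr0n// mulrC.
Qed.

(** Superadditivity of the geometric mean, for a constant second vector: apply
    the arithmetic-geometric inequality to p_i / (p_i + c) and to c / (p_i + c)
    and add, since these two fractions sum to 1.  Stated with powers, so that
    only a lower bound q for the geometric mean of p is required. *)
Lemma prod_shift_ge_pow (R : realType) (n : nat) (p : 'I_n -> R) (q c : R) :
  (0 < n)%N -> 0 <= q -> 0 < c -> (forall i, 0 <= p i) ->
  q ^+ n <= \prod_i p i -> (q + c) ^+ n <= \prod_i (p i + c).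
Proof.
move=> n0 q0 c0 p0 qp.
pose P := \prod_i (p i + c).
have pc i : 0 < p i + c by rewrite ltr_wpDl.
have P0 : 0 < P by apply: prodr_gt0 => i _; exact: pc.
have nR : 0 < n%:R :> R by rewrite ltr0n.
pose g := P `^ (n%:R)^-1.
have g0 : 0 < g by exact: powR_gt0.
have gn : g ^+ n = P.
  by rewrite /g -powR_mulrn ?powR_ge0// -powRrM mulVf ?gt_eqF// powRr1// ltW.
have A : n%:R * (q / g) <= \sum_i p i / (p i + c).
  apply: AGM_root_le_sum => // [|i|]; only 1, 2: by rewrite divr_ge0// ltW.
  rewrite big_split/= prodfV expr_div_n gn -/P.
  by rewrite ler_pM2r ?invr_gt0.
have B : n%:R * (c / g) <= \sum_i c / (p i + c).
  apply: AGM_root_le_sum => // [|i|]; only 1, 2: by rewrite divr_ge0// ltW.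
  rewrite big_split/= prodfV expr_div_n gn -/P prodr_const card_ord.
  by [].
have C : \sum_i p i / (p i + c) + \sum_i c / (p i + c) = n%:R.
  rewrite -big_split/= (eq_bigr (fun=> 1)); last first.
    by move=> i _; rewrite -mulrDl divff// gt_eqF.
  by rewrite sumr_const card_ord.
have : n%:R * ((q + c) / g) <= n%:R * 1.
  by rewrite mulrDl mulrDr mulr1 -[leRHS]C lerD.
rewrite ler_pM2l// ler_pdivrMr// mul1r => qg.
by rewrite -/P -gn lerXn2r// nnegrE ?(ltW g0)// addr_ge0// ltW.
Qed.

(** * Quadratic test functions *)

(** Only one-sided increments are used, so the point may lie on the upper faces
    of the cube. *)
Lemma derive_ge0_of_left_le (R : realType) (V : normedModType R) (f : V -> R)
    (x v : V) (d : R) : 0 < d -> derivable f x v ->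
  (forall t, 0 < t -> t < d -> f (x - t *: v) <= f x) -> 0 <= 'D_v f x.
Proof.
move=> d0 df H; rewrite leNgt; apply/negP => D0.
have /cvgrPdist_lt/(_ (- 'D_v f x)) := df; rewrite oppr_gt0 => /(_ D0).
rewrite -nbhs_nearE /= => /nbhs_ballP[e /= e0 He].
pose t := Num.min (e / 2) (d / 2).
have t0 : 0 < t by rewrite lt_min !divr_gt0.
have te : t < e by rewrite gt_min ltr_pdivrMr// ltr_pMr// ltr1n.
have td : t < d by rewrite gt_min orbC ltr_pdivrMr// ltr_pMr// ltr1n.
have := He (- t); rewrite /ball/= sub0r opprK gtr0_norm// => /(_ te).
rewrite oppr_eq0 gt_eqF// => /(_ isT).
have := H t t0 td; rewrite scaleNr addrC => h.
set z := (- t)^-1 * (f (- (t *: v) + x) - f x).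
have z0 : 0 <= z.
  by rewrite mulr_le0// ?invr_le0 ?oppr_le0 ?subr_le0// ltW.
rewrite -[X in `|_ - X| < _]/z -[lim _]/('D_v f x) distrC ger0_norm; lra.
Qed.

Section test.
Variables (R : realType) (n : nat).
Implicit Types (i j k : 'I_n) (x y : 'rV[R]_n) (a b : 'I_n -> R) (c : R).

Definition coordinate i : 'rV[R]_n -> R := fun y => y 0 i.

(** All test functions of the proof are of this form: separated squares for the
    penalty, and the product of one coordinate with the sum of all of them for
    the barrier. *)
Definition quadratic k a b c : 'rV[R]_n -> R :=
  \sum_i (a i \*: (coordinate i * coordinate i) + b i \*: coordinate i)
  + c \*: (coordinate k * \sum_i coordinate i).

Lemma quadraticE k a b c y : quadratic k a b c y =
  \sum_i (a i * y 0 i ^+ 2 + b i * y 0 i) + c * (y 0 k * \sum_i y 0 i).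
Proof.
by rewrite /quadratic !fct_sumE.
Qed.

Lemma is_derive_coordinate i x (v : 'rV[R]_n) :
  is_derive x v (coordinate i) (v 0 i).
Proof.
have df : differentiable (coordinate i) x by exact: differentiable_coord.
apply: DeriveDef; first exact: diff_derivable.
apply: cvg_lim => //; apply: cvg_near_cst.
near=> h; rewrite /coordinate /= !mxE addrK /GRing.scale/= mulrA mulVf ?mul1r//.
by near: h; exact: nbhs_dnbhs_neq.
Unshelve. all: by end_near. Qed.

Lemma partial_quadratic k a b c i x : partial i (quadratic k a b c) x =
  2 * a i * x 0 i + b i + c * (x 0 k + (if i == k then \sum_j x 0 j else 0)).
Proof.
pose e := delta_mx 0 i : 'rV[R]_n.
have E j : is_derive x e (coordinate j) ((i == j)%:R).
  by apply: (is_derive_eq (is_derive_coordinate j x e)); rewrite mxE eqxx eq_sym.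
rewrite /partial /quadratic.
have S1 : is_derive x e (\sum_j coordinate j) (\sum_j (i == j)%:R).
  exact: is_derive_sum.
have S2 j : is_derive x e
   (a j \*: (coordinate j * coordinate j) + b j \*: coordinate j)
   (a j *: (coordinate j x *: (i == j)%:R + coordinate j x *: (i == j)%:R)
    + b j *: (i == j)%:R).
  have := E j => Ej; exact: is_deriveD.
have S3 := is_derive_sum S2.
have Ek := E k.
have S4 := is_deriveD S3 (is_deriveZ c (is_deriveM Ek S1)).
rewrite (@derive_val _ _ _ _ _ _ _ S4) {S4 S3 S2 S1 Ek}.
rewrite fct_sumE /GRing.scale/= /coordinate (bigD1 i)//= big1; last first.
  by move=> j /negbTE; rewrite eq_sym => ->; rewrite mulr0n !mulr0 !addr0 !mulr0.
rewrite [\sum_j (i == j)%:R](bigD1 i)//= big1; last first.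
  by move=> j /negbTE; rewrite eq_sym => ->.
by rewrite eqxx; case: (i == k) => /=; ring.
Qed.

Lemma differentiable_quadratic k a b c x : differentiable (quadratic k a b c) x.
Proof.
have dc i : differentiable (coordinate i) x by exact: differentiable_coord.
apply: differentiableD.
  apply: differentiable_sum => i; apply: differentiableD.
    by apply: differentiableZ; exact: differentiableM.
  exact: differentiableZ.
apply: differentiableZ; apply: differentiableM => //.
exact: differentiable_sum.
Qed.

Lemma C1_quadratic k a b c : C1 (quadratic k a b c).
Proof.
split=> [x|i]; first exact: differentiable_quadratic.
rewrite (_ : partial i _ = quadratic k (fun=> 0) (fun j => (j == i)%:R * (2 * a i)
    + c * ((j == k)%:R + (i == k)%:R)) 0 + cst (b i)).
  move=> x; apply: continuousD; last exact: cst_continuous.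
  exact/differentiable_continuous/differentiable_quadratic.
apply/funext => x; rewrite partial_quadratic fctE quadraticE mul0r addr0.
have S m : \sum_j (j == m)%:R * x 0 j = x 0 m.
  rewrite (bigD1 m)//= eqxx mul1r big1 ?addr0// => j /negbTE ->.
  by rewrite mul0r.
rewrite [X in _ = X + _](eq_bigr (fun j => 2 * a i * ((j == i)%:R * x 0 j)
  + c * ((j == k)%:R * x 0 j) + c * (i == k)%:R * x 0 j)); last first.
  by move=> j _ /=; ring.
rewrite !big_split/= -!mulr_sumr !S.
by case: (i == k); rewrite /cst/=; ring.
Qed.

End test.

(** * The cube *)

Section cube.
Variables (R : realType) (n : nat).
Implicit Types (i j k : 'I_n) (x y : 'rV[R]_n).

Lemma compact_cube : compact (@cube R n).
Proof.
rewrite (_ : @cube R n = [set v | forall i, `[0, 1]%classic (v ord0 i)]).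
  exact: (@rV_compact R n (fun=> `[0, 1]%classic) (fun=> @segment_compact R 0 1)).
by apply/seteqP; split=> x /= H i; have := H i; rewrite in_itv.
Qed.

Definition set_coord x i (t : R) : 'rV[R]_n := \row_j (if j == i then t else x 0 j).

Lemma cube_set_coord x i t : cube x -> 0 <= t <= 1 -> cube (set_coord x i t).
Proof. by move=> Cx t01 j; rewrite mxE; case: ifP => // _; exact: Cx. Qed.

Lemma lo_cubeW x : lo_cube x -> cube x.
Proof. by move=> Lx i; have /andP[/ltW -> ->] := Lx i. Qed.

Lemma cube_gamma0 x i : cube x -> x 0 i = 0 -> cube_gamma x.
Proof.
move=> Cx xi0; split; last by move=> /(_ i); rewrite xi0 ltxx.
split; first exact: subset_closure.
move=> /nbhs_ballP[e /= e0 He].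
have /He/(_ i) : ball x e (set_coord x i (- (e / 2))).
  split=> // a j; rewrite (ord1 a) mxE /ball/=; case: eqP => [->|_].
    by rewrite xi0 sub0r opprK gtr0_norm ?divr_gt0// ltr_pdivrMr// ltr_pMr// ltr1n.
  by rewrite subrr normr0.
by rewrite mxE eqxx oppr_ge0 leNgt divr_gt0.
Qed.

Lemma cube_gammaVlo_cube x : cube x -> (exists i, x 0 i = 0) \/ lo_cube x.
Proof.
move=> Cx; have [[i xi0]|H] := pselect (exists i, x 0 i = 0).
  by left; exists i.
right=> i; have /andP[x0 ->] := Cx i; rewrite andbT lt_neqAle x0 andbT eq_sym.
by apply/eqP => xi0; apply: H; exists i.
Qed.

Lemma max_on_cube (g : 'rV[R]_n -> R) : {within @cube R n, continuous g} ->
  exists2 z, cube z & forall x, cube x -> g x <= g z.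
Proof.
move=> cg.
have [|z /set_mem Cz zmax] := compact_EVT_max _ compact_cube cg.
  by exists 0 => i; rewrite mxE lexx ler01.
by exists z => // x /mem_set; exact: zmax.
Qed.

Lemma max_on_cube2 (g : 'rV[R]_n * 'rV[R]_n -> R) :
  {within @cube R n `*` @cube R n, continuous g} ->
  exists X y, [/\ cube X, cube y & forall X' y', cube X' -> cube y' ->
    g (X', y') <= g (X, y)].
Proof.
move=> cg.
have [|[X y] /set_mem[/= CX Cy] zmax] :=
  compact_EVT_max _ (compact_setX compact_cube compact_cube) cg.
  by exists (0, 0); split=> i; rewrite mxE lexx ler01.
by exists X, y; split=> // X' y' ? ?; apply: zmax; rewrite inE.
Qed.

Lemma within_fst (A B : set 'rV[R]_n) (u : 'rV[R]_n -> R) :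
  {within A, continuous u} -> {within A `*` B, continuous (u \o fst)}.
Proof.
move=> /subspace_continuousP cu; apply/subspace_continuousP => -[a b] [/= Aa Bb].
apply: (@cvg_comp _ _ _ fst u _ (within A (nbhs a))); last exact: cu.
move=> P /= wP; rewrite /within/= in wP *.
exists ([set x | A x -> P x], setT) => /=; first by split=> //; exact: filterT.
by move=> [x y] /= [H _] [/H].
Qed.

Lemma within_snd (A B : set 'rV[R]_n) (u : 'rV[R]_n -> R) :
  {within B, continuous u} -> {within A `*` B, continuous (u \o snd)}.
Proof.
move=> /subspace_continuousP cu; apply/subspace_continuousP => -[a b] [/= Aa Bb].
apply: (@cvg_comp _ _ _ snd u _ (within B (nbhs b))); last exact: cu.
move=> P /= wP; rewrite /within/= in wP *.
exists (setT, [set x | B x -> P x]) => /=; first by split=> //; exact: filterT.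
by move=> [x y] /= [_ H] [_ /H].
Qed.

End cube.

(** * Elementary properties of a nondecreasing solution *)

Section solution.
Variables (R : realType) (n : nat) (f u : 'rV[R]_n -> R).
Hypothesis n_gt0 : (0 < n)%N.
Hypothesis visc : viscosity_solution_P1 f u.
Hypothesis mono : nondecreasing_cube u.
Implicit Types (i j k : 'I_n) (x y z : 'rV[R]_n).

Let cont_u : {within @cube R n, continuous u}.
Proof. by case: visc. Qed.

Lemma sol_eq0 x i : cube x -> x 0 i = 0 -> u x = 0.
Proof. by move=> Cx xi; case: visc => _ H _; apply: H; exact: cube_gamma0 xi. Qed.

Lemma sol_ge0 x : cube x -> 0 <= u x.
Proof.
move=> Cx; pose i := Ordinal n_gt0.
have C0 : cube (set_coord x i 0) by apply: cube_set_coord => //; rewrite lexx ler01.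
rewrite -(@sol_eq0 (set_coord x i 0) i) ?mxE ?eqxx//; apply: (mono C0 Cx (i := i)).
  by move=> j /negbTE ji; rewrite mxE ji.
by rewrite mxE eqxx; have /andP[] := Cx i.
Qed.

Lemma sol_subsolution phi z : lo_cube z -> C1 phi ->
  (forall x, cube x -> u x - phi x <= u z - phi z) ->
  \prod_i Num.max (partial i phi z) 0 <= f z.
Proof.
move=> Lz Cphi H; case: visc => _ _ /(_ z phi Lz Cphi)[+ _]; apply.
rewrite near_withinE; apply: nearW => x /lo_cubeW; exact: H.
Qed.

(** Since u is nondecreasing, a test function that touches it from below has a
    nonnegative gradient; this removes the positive parts, which would not
    survive adding a positive vector to the gradient. *)
Lemma sol_supersolution phi z : lo_cube z -> C1 phi ->
  (forall x, cube x -> u z - phi z <= u x - phi x) ->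
  (forall i, 0 <= partial i phi z) /\ f z <= \prod_i partial i phi z.
Proof.
move=> Lz Cphi H.
have p0 i : 0 <= partial i phi z.
  have /andP[zi0 zi1] := Lz i.
  apply: (derive_ge0_of_left_le zi0) => [|t t0 tz].
    exact/diff_derivable/Cphi.1.
  have E : z - t *: delta_mx 0 i = set_coord z i (z 0 i - t).
    apply/rowP => j; rewrite !mxE eqxx /=; case: eqP => [->|_].
      by rewrite mulr1.
    by rewrite mulr0 subr0.
  have Cz := lo_cubeW Lz.
  have C' : cube (set_coord z i (z 0 i - t)).
    by apply: cube_set_coord => //; apply/andP; split; lra.
  have := H _ C'; rewrite E.
  have : u (set_coord z i (z 0 i - t)) <= u z.
    apply: (mono C' Cz (i := i)); last by rewrite mxE eqxx; lra.
    by move=> j /negbTE ji; rewrite mxE ji.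
  lra.
split=> //; case: visc => _ _ /(_ z phi Lz Cphi)[_ /(_ _)].
rewrite (eq_bigr (fun i => partial i phi z)); last first.
  by move=> i _; rewrite max_l.
apply; rewrite near_withinE; apply: nearW => x /lo_cubeW; exact: H.
Qed.

(** A linear function with product of slopes larger than f is a strict
    supersolution, so u minus it can only reach its maximum on a face where
    u = 0. *)
Lemma sol_le_linear_barrier (b : 'I_n -> R) x : (forall i, 0 <= b i) ->
  (forall z, cube z -> f z < \prod_i b i) -> cube x ->
  u x <= \sum_i b i * x 0 i.
Proof.
move=> b0 fb Cx; pose k := Ordinal n_gt0.
pose phi := quadratic k (fun=> 0) b 0 : 'rV[R]_n -> R.
have phiE y : phi y = \sum_i b i * y 0 i.
  by rewrite /phi quadraticE mul0r addr0; apply: eq_bigr => i _; rewrite mul0r add0r.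
have [|z Cz zmax] := @max_on_cube _ _ (u - phi).
  apply: within_continuousB => //; apply: continuous_subspaceT => y.
  exact/differentiable_continuous/differentiable_quadratic.
have := zmax x Cx; rewrite !fctE -phiE.
have [[i zi0]|Lz] := cube_gammaVlo_cube Cz.
  rewrite (sol_eq0 Cz zi0).
  have : 0 <= phi z.
    rewrite phiE sumr_ge0// => j _; rewrite mulr_ge0//.
    by have /andP[] := Cz j.
  lra.
have := sol_subsolution Lz (C1_quadratic k _ b 0) zmax.
rewrite (eq_bigr b); last first.
  by move=> i _; rewrite partial_quadratic mulr0 mul0r mul0r addr0 add0r max_l.
by rewrite leNgt fb.
Qed.

(** The best linear barrier at x: slope b / x_k in direction k and b in the
    others, where b^n is slightly more than B x_k.  Its value at x is at most
    n b. *)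
Lemma sol_pow_le (B : R) k x : (forall z, cube z -> f z <= B) -> 0 <= B ->
  cube x -> u x ^+ n <= n%:R ^+ n * B * x 0 k.
Proof.
move=> fB B0 Cx.
have nR : 0 < n%:R :> R by rewrite ltr0n.
have [xk0|xk0] := eqVneq (x 0 k) 0.
  by rewrite (sol_eq0 Cx xk0) xk0 mulr0 expr0n gtn_eqF.
have {}xk0 : 0 < x 0 k by rewrite lt_neqAle eq_sym xk0; have /andP[] := Cx k.
apply/ler_addgt0Pr => e e0.
pose e' := e / (n%:R ^+ n * x 0 k).
have e'0 : 0 < e' by rewrite divr_gt0// mulr_gt0// exprn_gt0.
pose b := ((B + e') * x 0 k) `^ n%:R^-1.
have b0 : 0 < b by rewrite powR_gt0// mulr_gt0// ltr_wpDl.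
have bn : b ^+ n = (B + e') * x 0 k.
  rewrite /b -powR_mulrn ?powR_ge0// -powRrM mulVf ?gt_eqF// powRr1//.
  by rewrite mulr_ge0 ?(ltW xk0)// addr_ge0// ltW.
have : u x <= n%:R * b.
  have /(@sol_le_linear_barrier (fun i => if i == k then b / x 0 k else b)) := Cx.
  move=> /(_ _ _)/le_trans; apply.
  - by move=> i; case: eqP => _; rewrite ?divr_ge0// ltW.
  - move=> z Cz; rewrite (bigD1 k)//= eqxx (eq_bigr (fun=> b)); last first.
      by move=> i /negbTE ->.
    have : b / x 0 k * \prod_(i < n | i != k) b = B + e'.
      rewrite mulrAC -[RHS](mulfK (lt0r_neq0 xk0)) -bn; congr (_ / _).
      by rewrite prodr_const cardC1 card_ord -exprS prednK.
    by move=> ->; have := fB z Cz; lra.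
  - apply: (@le_trans _ _ (\sum_(i < n) b)); last first.
      by rewrite sumr_const card_ord mulr_natl.
    apply: ler_sum => i _; case: eqP => [->|_].
      by rewrite divfK// gt_eqF.
    by rewrite ler_piMr ?(ltW b0)//; have /andP[] := Cx i.
rewrite -(ler_pXn2r n_gt0) ?nnegrE ?sol_ge0 ?mulr_ge0 ?(ltW b0)//.
rewrite exprMn bn => /le_trans; apply; rewrite mulrDl mulrDr mulrA lerD2l.
by rewrite mulrCA /e' divfK ?lexx// lt0r_neq0// mulr_gt0// exprn_gt0.
Qed.
End solution.

(** * Comparison of the solution with its contraction *)

Section scaling.
Variables (R : realType) (n : nat) (F f u : 'rV[R]_n -> R) (M L : R).
Hypothesis n_gt0 : (0 < n)%N.
Hypothesis visc : viscosity_solution_P1 f u.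
Hypothesis mono : nondecreasing_cube u.
Hypothesis F0 : forall x, cube x -> 0 <= F x.
Hypothesis fE : forall x, cube x -> f x = F x ^+ n.
Hypothesis FM : forall x, cube x -> F x <= M.
Hypothesis M0 : 0 <= M.
Hypothesis L0 : 0 <= L.
Hypothesis FL : forall x y, cube x -> cube y ->
  F x - F y <= L * \sum_i `|x 0 i - y 0 i|.
Variables (k : 'I_n) (lam mu : R).
Hypothesis lam1 : 1 <= lam.
Hypothesis mu0 : 0 < mu.
Hypothesis muE : mu ^+ n = lam.
Implicit Types (i j : 'I_n) (x y : 'rV[R]_n).

Definition shrink_factor i : R := if i == k then lam^-1 else 1.
Definition shrink x : 'rV[R]_n := \row_i (shrink_factor i * x 0 i).

Let lam0 : 0 < lam. Proof. exact: lt_le_trans ltr01 _. Qed.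

Lemma shrink_factor_gt0 i : 0 < shrink_factor i.
Proof. by rewrite /shrink_factor; case: ifP => _; rewrite ?invr_gt0. Qed.

Lemma shrink_factor_le1 i : shrink_factor i <= 1.
Proof. by rewrite /shrink_factor; case: ifP => _ //; rewrite invf_le1. Qed.

Lemma cube_shrink x : cube x -> cube (shrink x).
Proof.
move=> Cx i; have /andP[x0 x1] := Cx i.
rewrite mxE mulr_ge0 ?(ltW (shrink_factor_gt0 _))//=.
by apply: le_trans x1; rewrite ler_piMl// shrink_factor_le1.
Qed.

Let K := L * (lam - 1).
Let K0 : 0 <= K. Proof. by rewrite mulr_ge0// subr_ge0. Qed.

(** This is K y_k (1 + sum_i y_i) + eps sum_i y_i.  Every partial derivative is
    at least K y_k + eps, as required to absorb the variation of F, while its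
    value is only of order K y_k + eps. *)
Definition barrier eps := quadratic k (fun=> 0) (fun i => K * (i == k)%:R + eps) K
  : 'rV[R]_n -> R.

Lemma barrier_ge0 eps y : 0 < eps -> cube y -> 0 <= barrier eps y.
Proof.
move=> e0 Cy; have y0 i : 0 <= y 0 i by have /andP[] := Cy i.
rewrite /barrier quadraticE addr_ge0//.
  apply: sumr_ge0 => i _; rewrite mul0r add0r mulr_ge0//.
  by rewrite addr_ge0 ?(ltW e0)// mulr_ge0// ler0n.
by rewrite mulr_ge0// mulr_ge0// sumr_ge0.
Qed.

Definition penalty (p : 'rV[R]_n * 'rV[R]_n) : R :=
  \sum_i (shrink_factor i * coordinate i p.1 - coordinate i p.2) ^+ 2.

Lemma continuous_penalty : continuous penalty.
Proof.
have cc i : continuous (coordinate i : 'rV[R]_n -> R) by exact: coord_continuous.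
rewrite /penalty; apply: continuous_big => [|i _ p]; first exact: add_continuous.
have c1 : continuous (fun p : 'rV[R]_n * 'rV[R]_n =>
    shrink_factor i * coordinate i p.1 - coordinate i p.2).
  move=> [a b]; apply: cvgB.
    apply: cvgM; first exact: cvg_cst.
    apply: (@cvg_comp _ _ _ fst (coordinate i) _ (nbhs a)); [exact: cvg_fst|exact: cc].
  apply: (@cvg_comp _ _ _ snd (coordinate i) _ (nbhs b)); [exact: cvg_snd|exact: cc].
exact: continuousM (c1 p) (c1 p).
Qed.

Lemma penalty_quadratic t X y : t * penalty (X, y) =
  quadratic k (fun i => t * shrink_factor i ^+ 2)
    (fun i => - 2 * t * shrink_factor i * y 0 i) 0 X
  + t * \sum_i y 0 i ^+ 2.
Proof.
rewrite quadraticE mul0r addr0 !mulr_sumr -big_split/=; apply: eq_bigr => i _.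
by rewrite /coordinate/=; ring.
Qed.

(** The function of y touching u from below at a maximum point of the doubled
    functional: minus t / mu times the penalty, minus the barrier, up to a
    constant. *)
Definition lower_test (t eps : R) (X : 'rV[R]_n) := quadratic k (fun=> - (t / mu))
  (fun i => 2 * (t / mu) * (shrink_factor i * X 0 i) - (K * (i == k)%:R + eps))
  (- K).

Lemma penalty_lower_test t eps X y : t * penalty (X, y) =
  t * (\sum_i (shrink_factor i * X 0 i) ^+ 2)
  - mu * (lower_test t eps X y + barrier eps y).
Proof.
rewrite /lower_test /barrier !quadraticE addrACA -big_split/= mulNr addNr addr0.
rewrite !mulr_sumr -sumrB; apply: eq_bigr => i _.
by rewrite /coordinate/=; field; exact: lt0r_neq0.
Qed.

Lemma prod_shrink_factor : \prod_i shrink_factor i = lam^-1.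
Proof.
rewrite (bigD1 k)//= /shrink_factor eqxx big1 ?mulr1// => i /negbTE ->.
by [].
Qed.

(** Doubling of variables.  At a maximum (X, y) of
    u(X) - mu (u + barrier)(y) - t penalty(X, y), the vector
    p_i = 2 t (s_i X_i - y_i), where s_i is the shrink factor, satisfies
      (prod p_i) / lam <= F(X)^n            as u is a subsolution at X,
      (F(y) + c)^n <= (prod p_i) / lam      as u is a supersolution at y,
    with c = K y_k + eps.  But F(X) - F(y) is at most L times the distance from
    X to y, that is K y_k up to a small error, which contradicts eps > 0. *)
Lemma scaling_comparison_eps eps X0 : 0 < eps -> cube X0 ->
  u X0 <= mu * (u (shrink X0) + barrier eps (shrink X0)).
Proof.
move=> eps0 CX0; rewrite leNgt; apply/negP => th0.
set W := fun y => u y + barrier eps y.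
have W0 y : cube y -> 0 <= W y.
  by move=> Cy; rewrite addr_ge0// ?(sol_ge0 n_gt0 visc mono)// barrier_ge0.
pose th := u X0 - mu * W (shrink X0).
have {}th0 : 0 < th by rewrite subr_gt0.
have [cu _ _] := visc.
have [xm Cxm umax] := max_on_cube cu.
pose U := u xm + 1.
have U0 : 0 < U by rewrite ltr_wpDl// (sol_ge0 n_gt0 visc mono).
pose T := n%:R ^+ n * M ^+ n.
have T0 : 0 <= T by rewrite mulr_ge0// exprn_ge0// ler0n.
have uT x i : cube x -> u x ^+ n <= T * x 0 i.
  apply: (sol_pow_le n_gt0 visc mono) => //; last by rewrite exprn_ge0.
  move=> z Cz; rewrite fE// lerXn2r ?nnegrE ?F0 ?FM//.
pose Q := L * (n%:R + lam).
have Q0 : 0 <= Q by rewrite mulr_ge0// addr_ge0 ?ler0n// ltW.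
(* the first bound keeps y off the faces where u = 0, the second makes the
   variation of F due to the doubling smaller than eps *)
pose del := Num.min (th ^+ n / (T * lam + 1)) (eps / (Q + 1)).
have d0 : 0 < del.
  have h : 0 < T * lam + 1 by rewrite ltr_wpDl// mulr_ge0// ltW.
  by rewrite lt_min !divr_gt0 ?exprn_gt0// ltr_wpDl.
have Td : T * lam * del < th ^+ n.
  have h : 0 < T * lam + 1 by rewrite ltr_wpDl// mulr_ge0// ltW.
  have : del <= th ^+ n / (T * lam + 1) by rewrite ge_min lexx.
  rewrite ler_pdivlMr// => h'; lra.
have Qd : Q * del < eps.
  have h : 0 < Q + 1 by rewrite ltr_wpDl.
  have : del <= eps / (Q + 1) by rewrite ge_min lexx orbT.
  rewrite ler_pdivlMr// => h'; lra.
(* large enough to force each |s_i X_i - y_i| < del at the maximum *)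
pose t := U / del ^+ 2.
have t0 : 0 < t by rewrite divr_gt0// exprn_gt0.
pose G p := u p.1 - mu * W p.2 - t * penalty p.
have [|X [y [CX Cy Gmax]]] := @max_on_cube2 R n G.
  have cb : {within @cube R n, continuous (barrier eps)}.
    apply: continuous_subspaceT => z.
    exact/differentiable_continuous/differentiable_quadratic.
  have cW : {within @cube R n, continuous W} by exact: within_continuousD.
  move=> z; apply: cvgB; last first.
    apply: cvgM; first exact: cvg_cst.
    exact: (continuous_subspaceT continuous_penalty).
  apply: cvgB; first exact: (within_fst cu).
  by apply: cvgM; [exact: cvg_cst|exact: (within_snd cW)].
have Gth : th <= G (X, y).
  apply: le_trans (Gmax _ _ CX0 (cube_shrink CX0)).
  rewrite /G/= /penalty big1 ?mulr0 ?subr0// => i _.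
  by rewrite /coordinate/= mxE subrr expr0n.
have P0 : 0 <= penalty (X, y) by apply: sumr_ge0 => i _; exact: sqr_ge0.
have tP0 : 0 <= t * penalty (X, y) by rewrite mulr_ge0// ltW.
have mW0 : 0 <= mu * W y by rewrite mulr_ge0 ?(ltW mu0)// W0.
have GE : G (X, y) = u X - mu * W y - t * penalty (X, y) by [].
have uX : th <= u X by lra.
have sd i : `|shrink_factor i * X 0 i - y 0 i| < del.
  have Pd : penalty (X, y) < del ^+ 2.
    have : t * penalty (X, y) < t * del ^+ 2.
      rewrite {2}/t divfK; last by rewrite lt0r_neq0// exprn_gt0.
      by have := umax _ CX; rewrite /U; lra.
    by rewrite ltr_pM2l.
  rewrite -(ltr_pXn2r (n := 2))// ?nnegrE ?normr_ge0 ?(ltW d0)//.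
  rewrite real_normK ?num_real//; apply: le_lt_trans Pd.
  rewrite /penalty (bigD1 i)//= lerDl sumr_ge0// => j _; exact: sqr_ge0.
have LX : lo_cube X.
  have [[i Xi]|//] := cube_gammaVlo_cube CX.
  by move: uX; rewrite (sol_eq0 visc CX Xi) leNgt th0.
have Xy i : X 0 i <= lam * (shrink_factor i * X 0 i).
  have /andP[X0' _] := CX i; rewrite mulrA ler_peMl//.
  by rewrite /shrink_factor; case: ifP => _; rewrite ?mulr1// divff// lt0r_neq0.
have Ly : lo_cube y.
  have [[i yi]|//] := cube_gammaVlo_cube Cy.
  have := sd i; rewrite yi subr0 ger0_norm; last first.
    by rewrite mulr_ge0 ?(ltW (shrink_factor_gt0 _))//; have /andP[] := CX i.
  rewrite -(ltr_pM2l lam0) => h.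
  have := uT X i CX; rewrite leNgt => /negP[].
  apply: (@le_lt_trans _ _ (T * lam * del)).
    by rewrite -mulrA ler_wpM2l// ltW// (le_lt_trans (Xy i)).
  by apply: lt_le_trans Td _; rewrite lerXn2r// nnegrE ?(ltW th0)//
    (sol_ge0 n_gt0 visc mono).
pose p i := 2 * t * (shrink_factor i * X 0 i - y 0 i).
have sub : \prod_i Num.max (shrink_factor i * p i) 0 <= f X.
  have := sol_subsolution visc LX (C1_quadratic k (fun i => t * shrink_factor i ^+ 2)
    (fun i => - 2 * t * shrink_factor i * y 0 i) 0).
  rewrite (eq_bigr (fun i => Num.max (shrink_factor i * p i) 0)); last first.
    by move=> i _; rewrite partial_quadratic /p; congr Num.max; ring.
  apply => x Cx; have := Gmax x y Cx Cy; rewrite /G/= !penalty_quadratic; lra.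
have [q0 sup] : (forall i, 0 <= partial i (lower_test t eps X) y) /\
    f y <= \prod_i partial i (lower_test t eps X) y.
  apply: (sol_supersolution (phi := lower_test t eps X) visc mono Ly) => [|x Cx].
    exact: C1_quadratic.
  have := Gmax X x CX Cx; rewrite /G/= !(penalty_lower_test t eps) => h.
  rewrite -(ler_pM2l mu0); move: h; rewrite /W; lra.
pose c := K * y 0 k + eps.
have yk0 : 0 < y 0 k by have /andP[] := Ly k.
have Ky0 : 0 <= K * y 0 k by rewrite mulr_ge0// ltW.
have c0 : 0 < c by rewrite ltr_wpDl.
have qp i : partial i (lower_test t eps X) y + c <= p i / mu.
  have -> : partial i (lower_test t eps X) y + c = p i / mu
     - K * ((i == k)%:R + if i == k then \sum_j y 0 j else 0).
    rewrite /lower_test partial_quadratic /c /p; field; exact: lt0r_neq0.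
  rewrite lerBlDr lerDl mulr_ge0// addr_ge0 ?ler0n//; case: ifP => // _.
  by apply: sumr_ge0 => j _; have /andP[] := Cy j.
have q1 : (F y + c) ^+ n <= \prod_i (p i / mu).
  apply: (@le_trans _ _ (\prod_i (partial i (lower_test t eps X) y + c))).
    by apply: prod_shift_ge_pow => //; [exact: F0|rewrite -fE].
  apply: ler_prod => i _; rewrite qp andbT addr_ge0// ltW//.
have p0 i : 0 <= p i.
  have : 0 <= p i / mu by apply: le_trans (qp i); rewrite addr_ge0// ltW.
  by rewrite ler_pdivlMr// mul0r.
have q2 : \prod_i (p i / mu) <= F X ^+ n.
  rewrite big_split/= prodr_const card_ord exprVn muE mulrC -prod_shrink_factor.
  rewrite -big_split/= -fE//; apply: le_trans sub.
  rewrite le_eqVlt; apply/orP; left; apply/eqP; apply: eq_bigr => i _.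
  by rewrite max_l// mulr_ge0// ltW// shrink_factor_gt0.
have : F y + c <= F X.
  rewrite -(ler_pXn2r n_gt0) ?nnegrE ?addr_ge0 ?F0 ?(ltW c0) ?(ltW eps0)//.
  exact: le_trans q2.
have FXy := FL CX Cy.
have S : \sum_i `|X 0 i - y 0 i| <=
    \sum_i (del + (i == k)%:R * ((lam - 1) * (y 0 k + del))).
  apply: ler_sum => i _; have := sd i; rewrite /shrink_factor; case: eqP => [->|_] /=.
    set x := lam^-1 * X 0 k; have XE : X 0 k = lam * x.
      by rewrite /x mulrA divff ?mul1r// lt0r_neq0.
    rewrite XE mul1r ltr_norml => /andP[h1 h2].
    have x0 : 0 <= x.
      by rewrite mulr_ge0// ?invr_ge0 ?(ltW lam0)//; have /andP[] := CX k.
    have l0 : 0 <= lam - 1 by rewrite subr_ge0.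
    have h3 : (lam - 1) * x <= (lam - 1) * (y 0 k + del).
      by rewrite ler_wpM2l//; lra.
    have h4 := mulr_ge0 l0 x0.
    by rewrite ler_norml; apply/andP; split; lra.
  by rewrite mul1r mul0r addr0 => /ltW.
have S2 : \sum_i (del + (i == k)%:R * ((lam - 1) * (y 0 k + del))) =
    n%:R * del + (lam - 1) * (y 0 k + del).
  rewrite big_split/= sumr_const card_ord mulr_natl -mulr_suml.
  by rewrite (bigD1 k)//= eqxx big1 ?addr0 ?mul1r// => i /negbTE ->.
have := ler_wpM2l L0 S; rewrite S2 /c /K; move: Qd; rewrite /Q.
have := mulr_ge0 L0 (ltW d0); lra.
Qed.
End scaling.

(** * The Lipschitz bound for the n-th power of the solution *)

Lemma pow_le_of_le_add (R : realType) (n : nat) (a z b B : R) :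
  0 <= a <= B -> 0 <= z <= B -> 0 <= b -> a <= z + b ->
  a ^+ n <= z ^+ n + b * (n%:R * B ^+ n.-1).
Proof.
move=> /andP[a0 aB] /andP[z0 zB] b0 ab.
have B0 : 0 <= B := le_trans a0 aB.
have BB : 0 <= n%:R * B ^+ n.-1 by rewrite mulr_ge0 ?ler0n ?exprn_ge0.
have [az|za] := leP a z.
  rewrite -[leLHS]addr0 lerD ?(mulr_ge0 b0 BB)//.
  by rewrite lerXn2r ?nnegrE.
rewrite -lerBlDl subrXX; apply: ler_pM; rewrite ?subr_ge0 ?(ltW za)//.
- by rewrite sumr_ge0// => i _; rewrite mulr_ge0 ?exprn_ge0.
- by rewrite lerBlDl.
- rewrite [leRHS](_ : _ = \sum_(i < n) B ^+ n.-1); last first.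
    by rewrite sumr_const card_ord mulr_natl.
  apply: ler_sum => i _.
  have -> : B ^+ n.-1 = B ^+ (n.-1 - i) * B ^+ i.
    rewrite -exprD subnK// -ltnS prednK ?ltn_ord// (leq_trans _ (ltn_ord i))//.
  by rewrite ler_pM ?exprn_ge0 ?lerXn2r ?nnegrE.
Qed.

(** Change the coordinates of x into those of y one at a time. *)
Lemma lipschitz_of_coordwise (R : realType) (n : nat) (g : 'rV[R]_n -> R) (c : R) :
  0 <= c ->
  (forall k x y, cube x -> cube y -> (forall j, j != k -> x 0 j = y 0 j) ->
     x 0 k <= y 0 k -> `|g x - g y| <= c * (y 0 k - x 0 k)) ->
  forall x y, cube x -> cube y -> `|g x - g y| <= c * \sum_i `|x 0 i - y 0 i|.
Proof.
move=> c0 H x y Cx Cy.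
have H2 k z w : cube z -> cube w -> (forall j, j != k -> z 0 j = w 0 j) ->
    `|g z - g w| <= c * `|z 0 k - w 0 k|.
  move=> Cz Cw zw; have [zk|/ltW zk] := leP (z 0 k) (w 0 k).
    by rewrite (distrC (z 0 k)) (ger0_norm (_ : 0 <= w 0 k - _)) ?subr_ge0// H.
  rewrite distrC (ger0_norm (_ : 0 <= z 0 k - _)) ?subr_ge0// H// => j jk.
  by rewrite zw.
pose z (s : seq 'I_n) : 'rV[R]_n := \row_i (if i \in s then y 0 i else x 0 i).
have Cz s : cube (z s).
  by move=> i; rewrite mxE; case: ifP => _; [exact: Cy|exact: Cx].
have -> : y = z (index_enum 'I_n).
  by apply/rowP => i; rewrite mxE mem_index_enum.
rewrite [X in c * X](eq_bigr (fun i => `|x 0 i - y 0 i|)); last first.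
  by move=> i _; rewrite mxE mem_index_enum.
elim: (index_enum _) => [|k s IH].
  rewrite big_nil mulr0 (_ : z [::] = x) ?subrr ?normr0//.
  by apply/rowP => i; rewrite mxE.
rewrite big_cons mulrDr [leRHS]addrC; apply: (le_trans (ler_distD (g (z s)) _ _)).
apply: lerD => //; apply: (le_trans (H2 k _ _ (Cz s) (Cz (k :: s)) _)).
  by move=> j /negbTE jk; rewrite !mxE inE jk.
rewrite ler_wpM2l// !mxE inE eqxx /=; case: ifP => // _.
by rewrite subrr normr0.
Qed.

Section estimate.
Variables (R : realType) (n : nat) (F f u : 'rV[R]_n -> R) (M L : R).
Hypothesis n_gt0 : (0 < n)%N.
Hypothesis visc : viscosity_solution_P1 f u.
Hypothesis mono : nondecreasing_cube u.
Hypothesis F0 : forall x, cube x -> 0 <= F x.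
Hypothesis fE : forall x, cube x -> f x = F x ^+ n.
Hypothesis FM : forall x, cube x -> F x <= M.
Hypothesis M0 : 0 <= M.
Hypothesis L0 : 0 <= L.
Hypothesis FL : forall x y, cube x -> cube y ->
  F x - F y <= L * \sum_i `|x 0 i - y 0 i|.
Implicit Types (i j k : 'I_n) (x y : 'rV[R]_n).

(** Let eps tend to 0; the barrier at the contracted point is at most
    (n + 1) K y_k, and K y_k is L times the displacement. *)
Lemma scaling_comparison k (lam mu : R) x : 1 <= lam -> 0 < mu -> mu ^+ n = lam ->
  cube x -> u x <= mu * (u (shrink k lam x) +
                n.+1%:R * (L * (x 0 k - shrink k lam x 0 k))).
Proof.
move=> lam1 mu0 muE Cx; apply/ler_addgt0Pr => e e0.
have nmu : 0 < mu * n%:R by rewrite mulr_gt0// ltr0n.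
have e'0 : 0 < e / (mu * n%:R) by rewrite divr_gt0.
have lam0 : 0 < lam by exact: lt_le_trans lam1.
apply: (le_trans (scaling_comparison_eps n_gt0 visc mono F0 fE FM M0 L0 FL
  k lam1 mu0 muE e'0 Cx)).
set y := shrink _ _ _; have Cy : cube y by exact: cube_shrink.
have xy : x 0 k - y 0 k = (lam - 1) * y 0 k.
  by rewrite /y mxE /shrink_factor eqxx; field; exact: lt0r_neq0.
have y0 i : 0 <= y 0 i by have /andP[] := Cy i.
have Sy : \sum_i y 0 i <= n%:R.
  apply: (@le_trans _ _ (\sum_(i < n) 1)); last by rewrite sumr_const card_ord.
  by apply: ler_sum => i _; have /andP[] := Cy i.
have Sy0 : 0 <= \sum_i y 0 i by apply: sumr_ge0.
have -> : barrier L k lam (e / (mu * n%:R)) y =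
    L * (lam - 1) * y 0 k * (1 + \sum_i y 0 i)
    + e / (mu * n%:R) * \sum_i y 0 i.
  rewrite /barrier quadraticE (eq_bigr (fun i => L * (lam - 1) * ((i == k)%:R * y 0 i)
     + e / (mu * n%:R) * y 0 i)); last by move=> i _; ring.
  rewrite big_split/= -!mulr_sumr [\sum_i _ * y 0 i](bigD1 k)//= eqxx big1; last first.
    by move=> i /negbTE ->; rewrite mul0r.
  by rewrite mulr1n; ring.
rewrite xy -[e in leRHS](_ : mu * (e / (mu * n%:R) * n%:R) = e); last first.
  by field; rewrite !lt0r_neq0// ltr0n.
rewrite -mulrDr ler_pM2l// addrA -addrA -[leRHS]addrA lerD2l lerD//; last first.
  by rewrite ler_pM2l.
have h : 0 <= L * (lam - 1) * y 0 k by rewrite mulr_ge0// mulr_ge0// subr_ge0.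
rewrite (_ : n.+1%:R * _ = L * (lam - 1) * y 0 k * n.+1%:R); last by ring.
by rewrite ler_wpM2l// -natr1 addrC lerD2r.
Qed.

Let uT k x : cube x -> u x ^+ n <= n%:R ^+ n * M ^+ n * x 0 k.
Proof.
move=> Cx; apply: (sol_pow_le n_gt0 visc mono) => //; last by rewrite exprn_ge0.
by move=> z Cz; rewrite fE// lerXn2r ?nnegrE ?F0 ?FM.
Qed.

(** With lam = y_k / x_k, the scaling comparison controls u(y)^n / lam by u(x)^n,
    and the remainder (1 - 1/lam) u(y)^n = u(y)^n / y_k (y_k - x_k) is controlled
    by the growth bound.  On the face x_k = 0 the growth bound alone is
    enough. *)
Lemma sol_pow_coord k x y : cube x -> cube y ->
  (forall j, j != k -> x 0 j = y 0 j) -> x 0 k <= y 0 k ->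
  u y ^+ n <= u x ^+ n +
    n%:R ^+ n * (M ^+ n + n.+1%:R * L * M ^+ n.-1) * (y 0 k - x 0 k).
Proof.
move=> Cx Cy xy xyk.
have u0 z : cube z -> 0 <= u z by exact: (sol_ge0 n_gt0 visc mono).
have nn0 : 0 <= n%:R ^+ n :> R by rewrite exprn_ge0 ?ler0n.
have LM : 0 <= n.+1%:R * L * M ^+ n.-1 by rewrite !mulr_ge0 ?exprn_ge0 ?ler0n.
have h0 : 0 <= y 0 k - x 0 k by rewrite subr_ge0.
have [xk0|xk0] := eqVneq (x 0 k) 0.
  rewrite (sol_eq0 visc Cx xk0) expr0n gtn_eqF// add0r xk0 subr0.
  apply: (le_trans (uT k Cy)); rewrite ler_wpM2r//; first by rewrite -xk0.
  by rewrite ler_wpM2l// lerDl.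
have {}xk0 : 0 < x 0 k by rewrite lt_neqAle eq_sym xk0; have /andP[] := Cx k.
have yk0 : 0 < y 0 k by exact: lt_le_trans xyk.
pose lam := y 0 k / x 0 k.
have lam1 : 1 <= lam by rewrite ler_pdivlMr// mul1r.
have lam0 : 0 < lam by exact: lt_le_trans lam1.
pose mu := lam `^ n%:R^-1.
have mu0 : 0 < mu by rewrite powR_gt0.
have muE : mu ^+ n = lam.
  by rewrite -powR_mulrn ?ltW// -powRrM mulVf ?powRr1 ?ltW// gt_eqF// ltr0n.
have cE : shrink k lam y = x.
  apply/rowP => i; rewrite mxE /shrink_factor; case: eqVneq => [->|ik].
    by rewrite invf_div divfK// lt0r_neq0.
  by rewrite mul1r xy.
have := scaling_comparison k lam1 mu0 muE Cy; rewrite cE.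
rewrite -ler_pdivrMl// mulrC; set a := u y / mu => ab.
have aE : a ^+ n = u y ^+ n / lam by rewrite expr_div_n muE.
have a0 : 0 <= a by rewrite divr_ge0 ?u0 ?ltW.
have nM0 : 0 <= n%:R * M by rewrite mulr_ge0 ?ler0n.
have uB z : cube z -> u z ^+ n <= (n%:R * M) ^+ n.
  move=> Cz; apply: (le_trans (uT k Cz)); rewrite exprMn ler_piMr ?mulr_ge0 ?exprn_ge0//.
  by have /andP[] := Cz k.
have aB : a <= n%:R * M.
  rewrite -(ler_pXn2r n_gt0) ?nnegrE// aE; apply: le_trans (uB _ Cy).
  by rewrite ler_pdivrMr// ler_peMr// exprn_ge0// u0.
have xB : u x <= n%:R * M.
  by rewrite -(ler_pXn2r n_gt0) ?nnegrE ?u0 ?uB.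
have b0 : 0 <= n.+1%:R * (L * (y 0 k - x 0 k)) by rewrite !mulr_ge0 ?ler0n.
have a0B : 0 <= a <= n%:R * M by rewrite a0.
have x0B : 0 <= u x <= n%:R * M by rewrite u0.
have := pow_le_of_le_add n a0B x0B b0 ab; rewrite aE => main.
have E1 : u y ^+ n = u y ^+ n / lam + u y ^+ n / y 0 k * (y 0 k - x 0 k).
  by rewrite /lam; field; rewrite !lt0r_neq0.
have E2 : u y ^+ n / y 0 k * (y 0 k - x 0 k) <= n%:R ^+ n * M ^+ n * (y 0 k - x 0 k).
  by rewrite ler_wpM2r// ler_pdivrMr// uT.
have E3 : n.+1%:R * (L * (y 0 k - x 0 k)) * (n%:R * (n%:R * M) ^+ n.-1) =
   n%:R ^+ n * (n.+1%:R * L * M ^+ n.-1) * (y 0 k - x 0 k).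
  have -> : n%:R ^+ n = n%:R * n%:R ^+ n.-1 :> R by rewrite -exprS prednK.
  by rewrite exprMn; ring.
rewrite E1; rewrite E3 in main.
lra.
Qed.

Lemma sol_pow_lipschitz (v : 'rV[R]_n -> R) :
  (forall x, cube x -> v x = u x ^+ n / n%:R ^+ n) ->
  forall x y, cube x -> cube y ->
  `|v x - v y| <= (M ^+ n + n.+1%:R * L * M ^+ n.-1) * \sum_i `|x 0 i - y 0 i|.
Proof.
move=> vE; have nn0 : 0 < n%:R ^+ n :> R by rewrite exprn_gt0 ?ltr0n.
apply: lipschitz_of_coordwise.
  by rewrite addr_ge0 ?mulr_ge0 ?exprn_ge0 ?ler0n.
move=> k x y Cx Cy xy xyk; rewrite !vE// -mulrBl normrM.
rewrite (gtr0_norm (_ : 0 < _^-1)) ?invr_gt0// ler_pdivrMr//.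
have uxy : u x <= u y by exact: mono xyk.
rewrite distrC ger0_norm; last first.
  by rewrite subr_ge0 lerXn2r ?nnegrE ?(sol_ge0 n_gt0 visc mono).
rewrite lerBlDl; apply: (le_trans (sol_pow_coord Cx Cy xy xyk)).
rewrite le_eqVlt; apply/orP; left; apply/eqP; ring.
Qed.

Lemma sol_pow_bounded (v : 'rV[R]_n -> R) :
  (forall x, cube x -> v x = u x ^+ n / n%:R ^+ n) ->
  forall x, cube x -> `|v x| <= M ^+ n.
Proof.
move=> vE x Cx; rewrite vE// ger0_norm; last first.
  by rewrite divr_ge0 ?exprn_ge0 ?(sol_ge0 n_gt0 visc mono) ?ler0n.
have nn0 : 0 < n%:R ^+ n :> R by rewrite exprn_gt0 ?ltr0n.
rewrite ler_pdivrMr//; apply: (le_trans (uT (Ordinal n_gt0) Cx)).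
have /andP[_ x1] := Cx (Ordinal n_gt0).
by rewrite [leRHS]mulrC ler_piMr// mulr_ge0 ?exprn_ge0 ?ler0n.
Qed.

End estimate.

(** * Essential supremum and supremum *)

Section tuple_box.
Variable R : realType.

Definition tuple_box n (a : nat -> R) (d : R) : set (n.-tuple (measurableTypeR R)) :=
  [set t | forall i : 'I_n, tnth t i \in `[a i, a i + d]].

Lemma measurable_tuple_box n a d : measurable (@tuple_box n a d).
Proof.
rewrite (_ : tuple_box a d =
    \bigcap_(i in [set: 'I_n]) (fun t => tnth t i) @^-1` `[a i, a i + d]).
  apply: fin_bigcap_measurable => [|i _]; first exact: finite_finset.
  by rewrite -[X in measurable X]setTI; exact: measurable_tnth.
by apply/seteqP; split=> t /= H i; [move=> _; exact: H|exact: H].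
Qed.

Lemma uniform_prob_itv (c d : R) : 0 <= c -> 0 < d -> c + d <= 1 ->
  uniform_prob (@ltr01 R) `[c, c + d] = d%:E.
Proof.
move=> c0 d0 cd; rewrite /uniform_prob (eq_integral (fun=> 1%:E)).
  rewrite integral_cst//= mul1e lebesgue_measure_itv/= lte_fin ltrDl d0.
  by rewrite -EFinB addrAC subrr add0r.
move=> x; rewrite inE/= in_itv/= => /andP[cx xd].
rewrite /uniform_pdf subr0 invr1 (le_trans c0 cx).
by rewrite (le_trans xd cd).
Qed.

Lemma lebesgue_cube_tuple_box n a d : 0 < d -> (forall i, 0 <= a i) ->
  (forall i, a i + d <= 1) -> lebesgue_cube R n (tuple_box a d) = (d ^+ n)%:E.
Proof.
move=> d0; elim: n a => [|n IH] a a0 a1.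
  rewrite /lebesgue_cube /= /dirac/= indicE mem_set ?expr0//.
  by move=> [].
rewrite /= /distribution /pushforward /=.
rewrite (_ : _ @^-1` _ = `[a 0%N, a 0%N + d]%classic `*` tuple_box (fun i => a i.+1) d).
  rewrite product_measure1E//=; last exact: measurable_tuple_box.
  rewrite [X in (_ * X)%E]IH//.
  by rewrite [uniform_prob _ _]uniform_prob_itv// -EFinM exprS.
apply/seteqP; split=> -[c t] /=.
  move=> H; split; first by have := H ord0; rewrite tnth0.
  by move=> i; have := H (lift ord0 i); rewrite tnthS.
move=> [Hc Ht] i; case: (unliftP ord0 i) => [j ->|->].
  by rewrite tnthS; exact: Ht.
by rewrite tnth0.
Qed.

(** Near any point of the cube, the cube contains a box of positive measure, so a
    lower bound near the point is a lower bound for the essential supremum.  The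
    box extends from each coordinate towards the centre of [0,1], because it has
    to stay inside the cube. *)
Lemma Linfty_norm_ge n (g : 'rV[R]_n -> R) (x : 'rV[R]_n) : cube x ->
  (forall e : R, 0 < e -> exists2 d : R, 0 < d & forall z, cube z ->
     (forall i, `|x 0 i - z 0 i| <= d) -> g x - e <= g z) ->
  ((g x)%:E <= Linfty_norm g)%E.
Proof.
move=> Cx Hx; apply/lee_subgt0Pr => e e0; rewrite leNgt; apply/negP => lt.
have [d0 d00 Hd0] := Hx e e0.
pose d : R := Num.min d0 2^-1.
have d_gt0 : 0 < d by rewrite lt_min d00 invr_gt0 ltr0n.
have dd0 : d <= d0 by rewrite ge_min lexx.
have d2 : d <= 2^-1 by rewrite ge_min lexx orbT.
pose a (i : nat) := if insub i is Some j then
  (if x 0 j <= 2^-1 then x 0 j else x 0 j - d) else 0.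
have aE (j : 'I_n) : a j = if x 0 j <= 2^-1 then x 0 j else x 0 j - d.
  by rewrite /a valK.
have a01 i : 0 <= a i /\ a i + d <= 1.
  rewrite /a; case: insubP => [j _ _|_]; last by split; lra.
  have /andP[x0 x1] := Cx j; case: (leP (x 0 j) 2^-1) => h; split; lra.
have mb : lebesgue_cube R n (tuple_box a d) = (d ^+ n)%:E.
  by apply: lebesgue_cube_tuple_box => // i; have [] := a01 i.
move: lt; rewrite /Linfty_norm Lnorm.unlock.
have -> : (0 < (lebesgue_cube R n : {measure set _ -> \bar R}) setT)%E.
  by rewrite [X in (_ < X)%E](@probability_setT _ _ _ (lebesgue_cube R n)) lte01.
set G := (X in ess_sup _ X) => lt.
have /ess_supP : (ess_sup (lebesgue_cube R n) G <=
    ess_sup (lebesgue_cube R n) G)%E by [].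
move=> [N [mN N0 GN]].
have bN : tuple_box a d `<=` N.
  move=> t Bt; apply: GN => /=; apply/negP; rewrite -ltNge.
  apply: (lt_le_trans lt).
  pose z : 'rV[R]_n := \row_i tnth t i.
  have : g x - e <= g z.
    have tb (i : 'I_n) : a i <= tnth t i <= a i + d by have := Bt i; rewrite in_itv.
    apply: Hd0 => i; rewrite mxE; have /andP[h1 h2] := tb i.
      by have [] := a01 i; move=> *; apply/andP; split; lra.
    have /andP[x0 x1] := Cx i.
    move: h1 h2; rewrite aE ler_norml; case: (leP (x 0 i) 2^-1) => h h1 h2;
      apply/andP; split; lra.
  rewrite /G /= => h; rewrite lee_fin; apply: (le_trans h); exact: ler_norm.
have : (lebesgue_cube R n (tuple_box a d) <= lebesgue_cube R n N)%E.
  apply: le_measure => //; rewrite inE//; exact: measurable_tuple_box.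
by rewrite mb N0 lee_fin leNgt exprn_gt0.
Qed.

End tuple_box.

(** * Norms and conclusion *)

Lemma sum_cst_ord (R : realType) (n : nat) (c : R) : \sum_(i < n) c = n%:R * c.
Proof. by rewrite sumr_const card_ord mulr_natl. Qed.

Section norms.
Variables (R : realType) (n : nat).
Implicit Types (x y : 'rV[R]_n) (g : 'rV[R]_n -> R) (c : R).

Lemma enorm_le_l1 x : enorm x <= \sum_i `|x 0 i|.
Proof.
have S0 : 0 <= \sum_i `|x 0 i| by apply: sumr_ge0.
rewrite /enorm -[leRHS]ger0_norm// -sqrtr_sqr ler_sqrt ?sqr_ge0//.
rewrite expr2 mulr_suml; apply: ler_sum => i _.
rewrite -real_normK ?num_real// expr2 ler_wpM2l//.
by rewrite (bigD1 i)//= lerDl sumr_ge0.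
Qed.

Lemma coord_le_enorm x i : `|x 0 i| <= enorm x.
Proof.
rewrite /enorm -sqrtr_sqr ler_sqrt ?sumr_ge0// => [|j _]; last exact: sqr_ge0.
by rewrite (bigD1 i)//= lerDl sumr_ge0// => j _; exact: sqr_ge0.
Qed.

Lemma enorm_gt0 x : x != 0 -> 0 < enorm x.
Proof.
move=> x0; rewrite lt_neqAle sqrtr_ge0 andbT eq_sym; apply: contra_neq x0 => e0.
apply/rowP => i; rewrite mxE; apply/eqP; rewrite -normr_le0 -e0.
exact: coord_le_enorm.
Qed.

Lemma lip_seminorm_le g c :
  (forall x y, cube x -> cube y -> `|g x - g y| <= c * enorm (x - y)) ->
  (lip_seminorm g <= c%:E)%E.
Proof.
move=> H; apply: ge_ereal_sup => _ [[x y] /= [Cx Cy xy] <-].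
by rewrite lee_fin ler_pdivrMr ?enorm_gt0 ?subr_eq0// H.
Qed.

Lemma le_lip_seminorm g c x y : (lip_seminorm g <= c%:E)%E ->
  cube x -> cube y -> `|g x - g y| <= c * enorm (x - y).
Proof.
move=> gc Cx Cy; have [->|xy] := eqVneq x y.
  rewrite !subrr normr0 /enorm big1 ?sqrtr0 ?mulr0// => i _.
  by rewrite mxE expr0n.
rewrite -ler_pdivrMr ?enorm_gt0 ?subr_eq0// -lee_fin.
by apply: le_trans gc; apply: ereal_sup_ubound; exists (x, y).
Qed.

Lemma sup_norm_le g c : (forall x, cube x -> `|g x| <= c) ->
  (sup_norm g <= c%:E)%E.
Proof. by move=> H; apply: ge_ereal_sup => _ [x /= Cx <-]; rewrite lee_fin H. Qed.

Lemma le_sup_norm g x : cube x -> (`|g x|%:E <= sup_norm g)%E.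
Proof. by move=> Cx; apply: ereal_sup_ubound; exists x. Qed.

Lemma lip_seminorm_ge0 g : (0 < n)%N -> (0 <= lip_seminorm g)%E.
Proof.
move=> n0; pose x := const_mx 0 : 'rV[R]_n; pose y := const_mx 1 : 'rV[R]_n.
have Cx : cube x by move=> i; rewrite mxE lexx ler01.
have Cy : cube y by move=> i; rewrite mxE lexx ler01.
have xy : x != y.
  apply/eqP => /rowP/(_ (Ordinal n0)); rewrite !mxE => /eqP.
  by rewrite eq_sym oner_eq0.
apply: (@le_trans _ _ (`|g x - g y| / enorm (x - y))%:E).
  by rewrite lee_fin divr_ge0// sqrtr_ge0.
by apply: ereal_sup_ubound; exists (x, y).
Qed.

Lemma in_C01_lip_seminorm g : (0 < n)%N -> in_C01 g ->
  exists2 l : R, lip_seminorm g = l%:E & 0 <= l.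
Proof.
move=> n0; rewrite /in_C01 /C01_norm.
have l0 := lip_seminorm_ge0 g n0.
have s0 : (0 <= sup_norm g)%E.
  have C0 : cube (0 : 'rV[R]_n) by move=> i; rewrite mxE lexx ler01.
  by apply: le_trans (le_sup_norm g C0); rewrite lee_fin.
move: l0 s0; case: (lip_seminorm g) => [l| |]; case: (sup_norm g) => [s| |]//.
by rewrite lee_fin => l0 _ _; exists l.
Qed.

End norms.

Lemma lipschitz_within_continuous (R : realType) (n : nat) (g : 'rV[R]_n -> R) (l : R) :
  0 <= l -> (forall x y, cube x -> cube y ->
    `|g x - g y| <= l * \sum_i `|x 0 i - y 0 i|) ->
  {within @cube R n, continuous g}.
Proof.
move=> l0 H; apply/subspace_continuousP => x Cx.
apply/cvgrPdist_lt => e e0; rewrite near_withinE.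
have d0 : 0 < e / (l * n%:R + 1) by rewrite divr_gt0// ltr_wpDl// mulr_ge0.
apply/nbhs_ballP; exists (e / (l * n%:R + 1)) => //= y [_ Bxy] Cy.
apply: (le_lt_trans (H x y Cx Cy)).
apply: (@le_lt_trans _ _ (l * (n%:R * (e / (l * n%:R + 1))))).
  rewrite ler_wpM2l// -sum_cst_ord.
  by apply: ler_sum => i _; exact: ltW (Bxy 0 i).
have h : 0 < l * n%:R + 1 by rewrite ltr_wpDl// mulr_ge0.
rewrite !mulrA ltr_pdivrMr//; lra.
Qed.

Unset Implicit Arguments.

Theorem lemma4p10 (R : realType) (n : nat) (hn : (1 <= n)%N) :
  exists C : R, forall f v : 'rV[R]_n -> R,
    (forall x, cube x -> 0 <= f x) ->
    in_C01 (fun x => f x `^ (1 / n%:R)) ->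
    maximal_viscosity_solution_P2 f v ->
    in_C01 v /\
    (lip_seminorm v <=
       C%:E * Linfty_norm (fun x => f x `^ ((n%:R - 1) / n%:R))%R
            * C01_norm (fun x => f x `^ (1 / n%:R))%R)%E.
Proof.
exists (n * n.+1)%:R => f v f0; set F := fun x => f x `^ (1 / n%:R).
move=> CF [u [visc mono vE]].
have nR : 0 < n%:R :> R by rewrite ltr0n.
have [L LE L0] := in_C01_lip_seminorm hn CF.
have F0 x : cube x -> 0 <= F x by move=> _; exact: powR_ge0.
have fE x : cube x -> f x = F x ^+ n.
  move=> Cx; rewrite /F -powR_mulrn ?powR_ge0// -powRrM divfK ?lt0r_neq0//.
  by rewrite powRr1// f0.
have FL1 x y : cube x -> cube y -> `|F x - F y| <= L * \sum_i `|x 0 i - y 0 i|.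
  move=> Cx Cy; apply: (@le_trans _ _ (L * enorm (x - y))).
    by apply: le_lip_seminorm => //; rewrite LE.
  rewrite ler_wpM2l// (le_trans (enorm_le_l1 _))//.
  by apply: ler_sum => i _; rewrite !mxE.
have FL x y : cube x -> cube y -> F x - F y <= L * \sum_i `|x 0 i - y 0 i|.
  by move=> Cx Cy; apply: le_trans (FL1 x y Cx Cy); exact: ler_norm.
have [z Cz Fz] := max_on_cube (lipschitz_within_continuous L0 FL1).
pose M := F z; have M0 : 0 <= M by exact: F0.
have Mn : M ^+ n = M * M ^+ n.-1 by rewrite -exprS prednK.
have Mn0 : 0 <= M ^+ n.-1 by rewrite exprn_ge0.
have LM0 : 0 <= n.+1%:R * L * M ^+ n.-1 by rewrite !mulr_ge0.
pose c := M ^+ n + n.+1%:R * L * M ^+ n.-1.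
have c0 : 0 <= c by rewrite addr_ge0// exprn_ge0.
have vlip : (lip_seminorm v <= (c * n%:R)%:E)%E.
  apply: lip_seminorm_le => x y Cx Cy.
  apply: (le_trans (sol_pow_lipschitz hn visc mono F0 fE Fz M0 L0 FL vE Cx Cy)).
  rewrite -/c -[leRHS]mulrA ler_wpM2l// -sum_cst_ord.
  apply: ler_sum => i _; have := coord_le_enorm (x - y) i.
  by rewrite !mxE.
split.
  rewrite /in_C01 /C01_norm.
  apply: (@le_lt_trans _ _ ((M ^+ n)%:E + (c * n%:R)%:E)%E); last by rewrite -EFinD ltry.
  apply: leeD => //; apply: sup_norm_le => x Cx.
  exact: (sol_pow_bounded hn visc mono F0 fE Fz M0 vE).
have MLinf : ((M ^+ n.-1)%:E <=
    Linfty_norm (fun x => f x `^ ((n%:R - 1) / n%:R))%R)%E.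
  have gE x : f x `^ ((n%:R - 1) / n%:R) = F x ^+ n.-1.
    rewrite -powR_mulrn ?powR_ge0// -powRrM -subn1 natrB//; congr (_ `^ _).
    by rewrite mulrAC mul1r.
  rewrite /M -gE; apply: (Linfty_norm_ge (g := fun x => f x `^ _)) => // e e0.
  pose q := L * n%:R * (n.-1%:R * M ^+ n.-1.-1).
  have q0 : 0 <= q by rewrite !mulr_ge0 ?exprn_ge0.
  have d0 : 0 < e / (q + 1) by rewrite divr_gt0// ltr_wpDl.
  exists (e / (q + 1)) => // y Cy zy; rewrite !gE.
  set d := e / (q + 1) in d0 zy *.
  have qd : q * d <= e.
    have h : 0 < q + 1 by rewrite ltr_wpDl.
    by rewrite /d mulrA ler_pdivrMr//; lra.
  have b0 : 0 <= L * (n%:R * d) by rewrite mulr_ge0// mulr_ge0// ltW.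
  have Mb : F z <= F y + L * (n%:R * d).
    rewrite -lerBlDl; apply: (le_trans (FL z y Cz Cy)).
    rewrite ler_wpM2l// -sum_cst_ord.
    by apply: ler_sum.
  have zB : 0 <= F z <= M by rewrite M0 lexx.
  have yB : 0 <= F y <= M by rewrite F0// Fz.
  have := pow_le_of_le_add n.-1 zB yB b0 Mb; rewrite lerBlDr => /le_trans; apply.
  rewrite lerD2l; apply: le_trans qd; rewrite /q le_eqVlt; apply/orP; left.
  by apply/eqP; ring.
apply: (le_trans vlip).
have Mle : ((M + L)%:E <= C01_norm F)%E.
  rewrite /C01_norm LE EFinD leeD// -[M]ger0_norm//; exact: le_sup_norm.
apply: (@le_trans _ _ ((n * n.+1)%:R%:E * (M ^+ n.-1)%:E * (M + L)%:E)%E).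
  rewrite -!EFinM lee_fin /c natrM Mn -natr1.
  have h1 : 0 <= n%:R * n%:R * (M * M ^+ n.-1) by rewrite !mulr_ge0.
  rewrite -subr_ge0 [X in 0 <= X](_ : _ = n%:R * n%:R * (M * M ^+ n.-1))//.
  by ring.
apply: lee_pmul => //; rewrite ?lee_fin ?addr_ge0//.
  by rewrite mulr_ge0.
by rewrite lee_wpmul2l ?lee_fin.
Qed.
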